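(* The set of fertility numbers has (natural asymptotic) density $1$ in the set of nonnegative integers.
   Context: A permutation is an ordering, written in one-line notation, of a finite set of positive integers. West's stack-sorting map $s$ is defined recursively: $s$ sends the empty permutation to itself, and if $\pi=LmR$ is a nonempty permutation with largest entry $m$, then $s(\pi)=s(L)\,s(R)\,m$. The fertility of a permutation $\pi$ is $|s^{-1}(\pi)|$. A fertility number is a nonnegative integer $f$ such that some permutation has fertility $f$. A set $A$ of nonnegative integers has density $\delta$ if $\lim_{N\to\infty}|A\cap\{0,\ldots,N\}|/N=\delta$. *)

(* Defs.v *)
From HB Require Import structures.
From mathcomp Require Import all_boot all_order all_algebra.
From mathcomp Require Import all_classical all_reals all_analysis.

Set Implicit Arguments.
Unset Strict Implicit.
Unset Printing Implicit Defensive.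

Import Order.TTheory GRing.Theory Num.Theory.
Import numFieldNormedType.Exports.

Local Open Scope classical_set_scope.
Local Open Scope card_scope.
Local Open Scope nat_scope.

Definition is_permutation (p : seq nat) : bool :=
  uniq p && all (fun x => 0 < x) p.

(* The first argument is fuel: the recursive calls are on strictly shorter
   words, so [size p] is always enough. *)
Fixpoint stack_sort_rec (k : nat) (p : seq nat) : seq nat :=
  if k is k'.+1 then
    if p is [::] then [::]
    else
      let m := \max_(x <- p) x in
      let i := index m p in
      stack_sort_rec k' (take i p) ++ stack_sort_rec k' (drop i.+1 p) ++ [:: m]
  else [::].

(* Total on words; it is West's map on those satisfying [is_permutation], by
   [stack_sort_nil] and [stack_sort_max]. *)
Definition stack_sort (p : seq nat) : seq nat := stack_sort_rec (size p) p.

Definition stack_preimage (p : seq nat) : set (seq nat) :=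
  [set q | is_permutation q /\ stack_sort q = p].

Definition has_fertility (p : seq nat) (f : nat) : Prop :=
  stack_preimage p #= `I_f.

Definition fertility_numbers : set nat :=
  [set f | exists p : seq nat, is_permutation p /\ has_fertility p f].

Definition has_density (R : realType) (A : set nat) (delta : R) : Prop :=
  (#|[set i : 'I_N.+1 | `[< A i >] ]%SET|%:R / N%:R : R)%R
    @[N --> \oo] --> delta.

Lemma stack_sort_recE k p :
  size p <= k -> stack_sort_rec k p = stack_sort p.
Proof.
suff H : forall n k' q, size q <= n -> size q <= k' ->
    stack_sort_rec k' q = stack_sort_rec n q.
  by move=> pk; apply: H.
elim=> [|n IHn] [|k'] [|x q] //.
rewrite [size _]/= !ltnS => qn qk.
have mq : \max_(y <- x :: q) y \in x :: q.
  elim: q x {qn qk} => [|y q IHq] x.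
    by rewrite big_cons big_nil maxn0 mem_head.
  by rewrite big_cons; case: leqP => _; rewrite inE ?eqxx // IHq orbT.
have := index_mem (\max_(y <- x :: q) y) (x :: q); rewrite mq.
cbn [stack_sort_rec]; set i := index _ _ => iq.
have sT : size (take i (x :: q)) <= size q by rewrite size_take iq -ltnS.
have sD : size (drop i.+1 (x :: q)) <= size q.
  by rewrite size_drop /= subSS leq_subr.
rewrite (IHn k' (take _ _)) ?(leq_trans sT) //.
by rewrite (IHn k' (drop _ _)) ?(leq_trans sD).
Qed.

Lemma stack_sort_nil : stack_sort [::] = [::].
Proof. by []. Qed.

Lemma stack_sort_max (L Q : seq nat) (m : nat) :
  all (fun x => x < m) (L ++ Q) ->
  stack_sort (L ++ m :: Q) = stack_sort L ++ stack_sort Q ++ [:: m].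
Proof.
rewrite all_cat => /andP[Lm Qm].
have maxE : \max_(x <- L ++ m :: Q) x = m.
  rewrite big_cat big_cons /=.
  have bnd s : all (fun x => x < m) s -> \max_(x <- s) x <= m.
    move=> /allP sm; apply/bigmax_leqP_seq => x xs _.
    exact/ltnW/sm.
  by rewrite (maxn_idPl (bnd _ Qm)) (maxn_idPr (bnd _ Lm)).
have mL : m \notin L.
  by apply/negP => /(allP Lm); rewrite ltnn.
have idx : index m (L ++ m :: Q) = size L.
  by rewrite index_cat (negbTE mL) /= eqxx addn0.
rewrite {1}/stack_sort size_cat /= addnS /=.
case E : (L ++ m :: Q) => [|a s]; first by case: (L) E.
rewrite -E maxE idx take_size_cat //.
have -> : drop (size L).+1 (L ++ m :: Q) = Q.
  by rewrite -cat_rcons drop_size_cat ?size_rcons.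
by rewrite !stack_sort_recE ?leq_addr ?leq_addl.
Qed.

(* Main.v *)
(* Fertilities are computed by splitting: if the last entry m of a word t m is
   its maximum, then the fertility of t m is the sum, over the splittings
   t = t1 t2, of the products of the fertilities of t1 and t2;
     otherwise it is 0.
   Putting c descending entries in front of a block and enough ascending larger
   entries behind it gives fertilities governed by simple recurrences in c, and
   two nested applications produce every number a (4 c + 2 a + 3) with a >= 1
   and c >= 0.

   Given k and z, a large n that is not divisible by 2^k but has a prime divisor
   p <= z with p = 3 mod 4 is of this form: if 2^e is the exact power of 2
   dividing n, then a = 2^e or a = 2^e p works, as n / a changes its class
   mod 4 between the two choices. It remains to see that
   P(z) = prod (1 - 1/p), over the primes p <= z with p = 3 mod 4, tends to 0.
   Let chi be the nontrivial character mod 4 and S(z) the sum of 1/n over the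
   n <= z all of whose prime factors are 1 mod 4. For such n the divisor sum of
   chi is the number of divisors, and it is nonnegative for all n, whence
   S(z)^2 <= sum_{n <= z^2} (1/n) sum_{d | n} chi(d) <= H(z^2) <= 2 H(z), the
   middle step because the sum over d is alternating with decreasing terms.
   On the other hand H(z) P(z) / 2 <= S(z), and so H(z) P(z)^2 <= 8. *)

Require Import Defs.
From HB Require Import structures.
From mathcomp Require Import all_boot all_order all_algebra.
From mathcomp Require Import all_classical all_reals all_analysis.
From mathcomp Require Import finmap zify ring lra.

Set Implicit Arguments.
Unset Strict Implicit.
Unset Printing Implicit Defensive.

Import Order.TTheory GRing.Theory Num.Theory.
Import numFieldNormedType.Exports.

Local Open Scope classical_set_scope.
Local Open Scope nat_scope.

(** * Fertility by splitting at the maximum *)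

Lemma uniq_split_max (q : seq nat) : uniq q -> q != [::] ->
  exists L m R, q = L ++ m :: R /\ all (fun x => x < m) (L ++ R).
Proof.
elim: q => // x q IH /= /andP[xq uq] _.
have [->|/(IH uq)[L [m [R [qE lt_m]]]]] := eqVneq q [::];
  first by exists [::], x, [::].
move: xq; rewrite qE mem_cat inE !negb_or => /and3P[_ xm _].
have [x_lt|m_le] := ltnP x m; first by exists (x :: L), m, R; rewrite /= x_lt.
exists [::], x, (L ++ m :: R); split => //=.
have m_lt : m < x by rewrite ltn_neqAle eq_sym xm.
have lt_x y : y < m -> y < x by move=> /ltn_trans; apply.
by move: lt_m; rewrite !all_cat /= m_lt =>
  /andP[/(sub_all lt_x)-> /(sub_all lt_x)->].
Qed.

Lemma perm_stack_sort q : uniq q -> perm_eq (stack_sort q) q.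
Proof.
have [n] := ubnP (size q); elim: n q => // n IH q sq uq.
have [->//|/(uniq_split_max uq)[L [m [R [qE lt_m]]]]] := eqVneq q [::].
rewrite qE stack_sort_max //.
move: uq sq; rewrite qE cat_uniq size_cat /= => /and3P[uL _ /andP[_ uR]] sq.
rewrite catA cats1 perm_rcons perm_sym perm_catC /= perm_cons perm_sym
  perm_catC.
have [sL sR] : size L < n /\ size R < n by lia.
by rewrite perm_cat ?IH.
Qed.

Lemma stack_sort_rcons q t m : uniq q -> stack_sort q = rcons t m ->
  exists L R, [/\ q = L ++ m :: R, t = stack_sort L ++ stack_sort R &
                  all (fun x => x < m) (L ++ R)].
Proof.
move=> uq; have [->|/(uniq_split_max uq)[L [M [R [-> lt_m]]]]] := eqVneq q [::].
  by case: t.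
rewrite stack_sort_max // catA cats1 => /rcons_inj[<- <-].
by exists L, R.
Qed.

(** Sorting [L ++ m :: R] around its maximum [m] gives the sorted [L], then the sorted [R], then
    [m]. So a preimage of [rcons t m] arises from preimages of a prefix and of the complementary
    suffix of [t]. [k] is fuel, enough once [size p <= k]. *)
Fixpoint preimages_rec (k : nat) (p : seq nat) : seq (seq nat) :=
  if k is k'.+1 then
    if p is x :: p' then
      let m := last x p' in let t := belast x p' in
      if all (fun y => y < m) t then
        [seq LR.1 ++ m :: LR.2 | i <- iota 0 (size t).+1,
           LR <- [seq (L, R) | L <- preimages_rec k' (take i t),
                               R <- preimages_rec k' (drop i t)]]
      else [::]
    else [:: [::]]
  else if p is [::] then [:: [::]] else [::].

Lemma preimages_rec_rcons k t m :
  preimages_rec k.+1 (rcons t m) =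
  if all (fun y => y < m) t then
    [seq LR.1 ++ m :: LR.2 | i <- iota 0 (size t).+1,
       LR <- [seq (L, R) | L <- preimages_rec k (take i t),
                           R <- preimages_rec k (drop i t)]]
  else [::].
Proof.
case: t => [|x t] //.
by rewrite rcons_cons /preimages_rec last_rcons belast_rcons.
Qed.

(** Sorting permutes the entries, so the cut of [t] lies at [size L], and the entries of [t] are
    those of [L ++ R], all below [m]. *)
Lemma mem_preimages_rec k p q : size p <= k -> uniq p ->
  (q \in preimages_rec k p) = uniq q && (stack_sort q == p).
Proof.
have nilE r : (r \in [:: [::]]) = uniq r && (stack_sort r == [::]).
  rewrite inE; apply/eqP/andP => [->//|[ur /eqP r0]].
  by apply/nilP; rewrite /nilp -(perm_size (perm_stack_sort ur)) r0.
elim: k p q => [|k IH] p q; first by case: p => // _ _; exact: nilE.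
case/lastP: p => [|t m] //.
rewrite size_rcons ltnS => tk utm; rewrite preimages_rec_rcons.
have [mt ut] : m \notin t /\ uniq t by move: utm; rewrite rcons_uniq => /andP[].
have sub i : size (take i t) <= k /\ size (drop i t) <= k.
  by split; apply: leq_trans tk; rewrite ?size_take_min ?size_drop; lia.
apply/idP/andP => [|[uq /eqP qE]].
  case: ifP => // lt_m /allpairsPdep[i [[L R] [_ /allpairsP[[L' R'] /=]]]].
  move=> [+ + [-> ->] ->] {L R}; have [sT sD] := sub i.
  rewrite !IH ?take_uniq ?drop_uniq // => /andP[uL /eqP LE] /andP[uR /eqP RE].
  have pL := perm_stack_sort uL; have pR := perm_stack_sort uR.
  have pt : perm_eq t (L' ++ R').
    by rewrite -(cat_take_drop i t) -LE -RE perm_cat.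
  rewrite stack_sort_max -?(perm_all _ pt) // catA LE RE cat_take_drop cats1.
  split=> //; rewrite -(@perm_uniq _ (rcons t m)) //.
  rewrite perm_rcons perm_sym -cat1s perm_catCA /= perm_cons perm_sym.
  exact: pt.
have [L [R [qLR tLR lt_m]]] := stack_sort_rcons uq qE.
move: (uq); rewrite qLR cat_uniq cons_uniq => /and3P[uL _ /andP[_ uR]].
have pL := perm_stack_sort uL; have pR := perm_stack_sort uR.
have pt : perm_eq t (L ++ R) by rewrite tLR perm_cat.
rewrite ifT ?(perm_all _ pt) //.
apply/allpairsPdep; exists (size L), (L, R); split => //.
  by rewrite mem_iota (perm_size pt) size_cat add0n ltnS leq0n leq_addr.
have [sT sD] := sub (size L); apply/allpairsP; exists (L, R); split => //=.
  by rewrite IH ?take_uniq // uL tLR take_size_cat ?(perm_size pL) //=.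
by rewrite IH ?drop_uniq // uR tLR drop_size_cat ?(perm_size pL) //=.
Qed.

(** Since [m] occurs in no [L], its position in a listed word recovers the cut [i], and then [L] and
    [R]. *)
Lemma uniq_preimages_rec k p : size p <= k -> uniq p -> uniq (preimages_rec k
  p).
Proof.
elim: k p => [|k IH] p; first by case: p.
case/lastP: p => [|t m] //; rewrite size_rcons ltnS => tk utm.
rewrite preimages_rec_rcons; case: ifP => // lt_m.
have [mt ut] : m \notin t /\ uniq t by move: utm; rewrite rcons_uniq => /andP[].
have sub i : size (take i t) <= k /\ size (drop i t) <= k.
  by split; apply: leq_trans tk; rewrite ?size_take_min ?size_drop; lia.
have memP i LR : i < (size t).+1 ->
    LR \in [seq (L, R) | L <- preimages_rec k (take i t),
                         R <- preimages_rec k (drop i t)] ->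
    size LR.1 = i /\ m \notin LR.1.
  move=> it /allpairsP[[L R] /= [+ _ ->]]; have [sT _] := sub i.
  rewrite mem_preimages_rec ?take_uniq // => /andP[uL /eqP LE] /=.
  have pL := perm_stack_sort uL; split.
    by rewrite -(perm_size pL) LE size_takel.
  by rewrite -(perm_mem pL) LE; apply: contra mt => /mem_take.
apply: allpairs_uniq_dep; first exact: iota_uniq.
  move=> i _; have [sT sD] := sub i.
  by apply: allpairs_uniq; rewrite ?IH ?take_uniq ?drop_uniq // => -[? ?] [? ?].
move=> _ _ /allpairsPdep[i [LR [+ LRi ->]]] /allpairsPdep[j [LR' [+ LRj ->]]]
  /=.
rewrite !mem_iota /= => /memP/(_ LRi)[sL mL] /memP/(_ LRj)[sL' mL'] E.
case: LR LR' {LRi LRj} sL mL sL' mL' E => [L R] [L' R'] /= sL mL sL' mL' E.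
have ij : i = j.
  have /(congr1 (index m)) := E.
  by rewrite !index_cat (negbTE mL) (negbTE mL') /= eqxx !addn0 sL sL'.
subst j; move/eqP: E; rewrite eqseq_cat ?sL ?sL' // => /andP[/eqP-> /eqP[->]].
by rewrite ij.
Qed.

Definition fertility (p : seq nat) : nat := size (preimages_rec (size p) p).

Lemma size_preimages_rec k p : uniq p -> size p <= k ->
  size (preimages_rec k p) = fertility p.
Proof.
move=> up pk; apply/perm_size/uniq_perm; rewrite ?uniq_preimages_rec //.
by move=> q; rewrite !mem_preimages_rec.
Qed.

Lemma fertility_nil : fertility [::] = 1.
Proof. by []. Qed.

Lemma fertility_rcons t m : uniq t -> all (fun y => y < m) t ->
  fertility (rcons t m) =
  \sum_(0 <= i < (size t).+1) fertility (take i t) * fertility (drop i t).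
Proof.
move=> ut lt_m; rewrite /fertility size_rcons preimages_rec_rcons lt_m.
rewrite size_allpairs_dep sumnE big_map /index_iota subn0.
apply: eq_bigr => i _; rewrite size_allpairs.
by rewrite !size_preimages_rec ?take_uniq ?drop_uniq // ?size_take_min
  ?size_drop
  ?geq_minr ?leq_subr.
Qed.

(** The image of a nonempty word ends in its maximum, whereas here the last entry lies below [x]. *)
Lemma fertility_infertile x u : u != [::] -> all (fun y => y < x) u ->
  fertility (x :: u) = 0.
Proof.
case/lastP: u => // u m _ /allP lt_x; rewrite /fertility -rcons_cons size_rcons.
rewrite preimages_rec_rcons [all _ _]/=.
have := lt_x m; rewrite mem_rcons mem_head => /(_ isT) /ltnW.
by rewrite leqNgt => /negbTE->.
Qed.

(** A preimage has the same entries as [p], so positivity carries over; the list, being free of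
    duplicates, has the cardinality of the preimage set. *)
Lemma fertilityP p : is_permutation p -> fertility_numbers (fertility p).
Proof.
move=> /[dup] pp /andP[up p0]; exists p; split=> //.
rewrite /has_fertility /stack_preimage.
have -> : [set q | is_permutation q /\ stack_sort q = p]%classic =
          [set` preimages_rec (size p) p]%classic.
  apply/seteqP; split => q /=; rewrite mem_preimages_rec //.
    by move=> [/andP[-> _] ->] /=.
  move=> /andP[uq /eqP qp]; split => //; rewrite /is_permutation uq /=.
  by rewrite -(perm_all _ (perm_stack_sort uq)) qp.
rewrite /fertility -(undup_id (uniq_preimages_rec (leqnn _) up)).
rewrite -(size_seq_fset tt).
have -> : ([set` undup (preimages_rec (size p) p)] =
    [set` seq_fset tt (preimages_rec (size p) p)])%classic.
  by apply: eq_set => q; rewrite seq_fsetE mem_undup.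
exact/card_eq_fsetP.
Qed.

(** * Words with prescribed fertility *)

Lemma fertility_seq1 x : fertility [:: x] = 1.
Proof. by []. Qed.

(** The cuts of [x :: u ++ Y] before [x] and right after [x] give the first two terms. A later cut
    inside [u] or at its end leaves an infertile prefix, so only cuts after [j >= 1] entries of [Y]
    remain. *)
Lemma fertility_cat_rcons x u (Y : seq nat) y :
  uniq (x :: u ++ Y) -> u != [::] -> all (fun z => z < x) u ->
  all (fun z => z < y) (x :: u ++ Y) ->
  fertility (x :: u ++ rcons Y y) =
    fertility (x :: u ++ Y) + fertility (u ++ Y) +
    \sum_(1 <= j < (size Y).+1)
      fertility (x :: u ++ take j Y) * fertility (drop j Y).
Proof.
move=> ut u0 lt_x lt_y; rewrite -rcons_cat -rcons_cons fertility_rcons //.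
rewrite big_nat_recl // take0 drop0 fertility_nil mul1n -addnA; congr addn.
rewrite [size _]/= big_nat_recl //= take0 drop0 fertility_seq1 mul1n;
  congr addn.
rewrite size_cat (@big_cat_nat _ _ _ (size u)) ?leq_addr //=.
rewrite big1_seq ?add0n => [|i]; last first.
  rewrite mem_index_iota andTb => iu.
  have -> : take i.+1 (u ++ Y) = take i.+1 u.
    rewrite take_cat; case: ltnP => // ui.
    by rewrite (eqP (iu : i.+1 - size u == 0)) take0 cats0 take_oversize.
  rewrite fertility_infertile //.
    by case: u {lt_x ut lt_y} u0 iu.
  by apply/allP => z /mem_take; apply: (allP lt_x).
rewrite -{1}[size u]add0n big_addn addnC addnK [RHS]big_add1 /=.
apply: eq_bigr => j _; rewrite -addSn take_cat drop_cat.
by rewrite ltnNge leq_addl /= addnK.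
Qed.

(** * Descending entries before a block, ascending entries behind it *)

Definition above (u Y : seq nat) : bool := pairwise ltn Y && allrel ltn u Y.

Lemma above_rcons u Y y :
  above u (rcons Y y) = above u Y && all (fun z => z < y) (u ++ Y).
Proof.
rewrite /above -cats1 pairwise_cat allrel_catr !allrel1r all_cat /= andbT.
by case: (all _ Y); case: (pairwise _ Y); case: allrel; case: (all _ u).
Qed.

Lemma above_catr u Y Z : above u (Y ++ Z) = above u Y && above (u ++ Y) Z.
Proof.
rewrite /above pairwise_cat allrel_catr allrel_catl.
by case: (allrel _ u Y); case: (allrel _ u Z); case: (allrel _ Y Z);
  case: pairwise; case: pairwise.
Qed.

Lemma above_catl u v Y : above (u ++ v) Y -> above u Y /\ above v Y.
Proof. by rewrite /above allrel_catl => /and3P[-> -> ->]. Qed.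

Lemma above_take u Y j : above u Y -> above u (take j Y).
Proof. by rewrite -{1}[Y](cat_take_drop j) above_catr => /andP[]. Qed.

Lemma above_uniq u Y : uniq u -> above u Y -> uniq (u ++ Y).
Proof.
elim/last_ind: Y => [|Y y IH] uu; first by rewrite cats0.
rewrite above_rcons => /andP[aY lt_y];
  rewrite -rcons_cat rcons_uniq IH // andbT.
by apply/negP => /(allP lt_y); rewrite ltnn.
Qed.

Definition descends_to (X w : seq nat) : bool :=
  [&& uniq w, w != [::], pairwise gtn X & allrel gtn X w].

Lemma descends_to_cons x X w :
  descends_to (x :: X) w = descends_to X w && all (fun z => z < x) (X ++ w).
Proof.
rewrite /descends_to /= allrel_consl all_cat.
by case: (uniq w); case: (w != [::]); case: pairwise; case: allrel;
  rewrite ?andbT ?andbF.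
Qed.

Lemma descends_to_uniq X w : descends_to X w -> uniq (X ++ w).
Proof.
elim: X => [|x X IH]; first by case/and4P.
rewrite descends_to_cons => /andP[/IH uXw lt_x] /=; rewrite uXw andbT.
by apply/negP => /(allP lt_x); rewrite ltnn.
Qed.

(** In every factor containing [w] the ascending part has become shorter, and only the second term
    also loses [x]. The side conditions are returned for the inductions below. *)
Lemma fertility_step x X w Y y :
  descends_to (x :: X) w -> above (x :: X ++ w) (rcons Y y) ->
  [/\ descends_to X w, above (x :: X ++ w) Y, above (X ++ w) Y &
  fertility (x :: X ++ w ++ rcons Y y) =
    fertility (x :: X ++ w ++ Y) + fertility (X ++ w ++ Y) +
    \sum_(1 <= j < (size Y).+1)
      fertility (x :: X ++ w ++ take j Y) * fertility (drop j Y)].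
Proof.
move=> dXw; have ux := descends_to_uniq dXw.
move: (dXw); rewrite descends_to_cons => /andP[dX lt_x].
rewrite above_rcons => /andP[aY lt_y]; have uY := above_uniq ux aY.
have := aY; rewrite -cat1s => /above_catl[_ aY'].
split => //; rewrite !catA fertility_cat_rcons //.
  by congr addn; apply: eq_bigr => j _; rewrite catA.
by case/and4P: dX => _; case: (X); case: w {dXw ux lt_x aY lt_y uY aY'}.
Qed.

(** Every term of [fertility_step] again has fewer ascending than descending entries, whence an
    outer induction on [X] and an inner one on the length of [Y]. *)
Lemma fertility_desc_eq0 X w Y : descends_to X w -> above (X ++ w) Y ->
  size Y < size X -> fertility (X ++ w ++ Y) = 0.
Proof.
elim: X Y => // x X IHX Y; have [n] := ubnP (size Y).
elim: n Y => // n IHn Y; case/lastP: Y => [_|Y y].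
  rewrite descends_to_cons => /andP[/and4P[_ w0 _ _] lt_x] _ _.
  rewrite cats0 /= fertility_infertile //.
  by case: (X); first exact: w0.
rewrite size_rcons ltnS /= => sY dX aY sYX.
have [dX' aY1 aY2 ->] := fertility_step dX aY.
rewrite (IHn Y) ?(IHX Y) ?add0n //; last by rewrite /= ltnW.
rewrite big1_seq // => j; rewrite mem_index_iota => /andP[_ jY].
rewrite (IHn (take j Y)) ?above_take //; first by rewrite size_take_min; lia.
by rewrite size_take_min /=; lia.
Qed.

Section Profile.
Variables (w : seq nat) (h0 h1 h2 : nat).
Hypothesis H0 : fertility w = h0.

(** [h0], [h1], [h2] are the fertilities of [w] followed by zero, one or two larger ascending
    entries. With equal lengths, only the term of [fertility_step] that loses both [x] and [y]
    survives. *)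
Lemma fertility_desc0 X Y : descends_to X w -> above (X ++ w) Y ->
  size Y = size X -> fertility (X ++ w ++ Y) = h0.
Proof.
elim: X Y => [|x X IHX] Y; first by move=> _ _ /size0nil->; rewrite cats0.
case/lastP: Y => // Y y dX aY; rewrite size_rcons => -[sY].
have [dX' aY1 aY2 ->] := fertility_step dX aY.
rewrite (@fertility_desc_eq0 (x :: X)) ?sY // IHX // add0n big1_seq ?addn0 // =>
  j.
rewrite mem_index_iota => /andP[_ jY].
by rewrite (@fertility_desc_eq0 (x :: X)) ?above_take // size_take_min /=; lia.
Qed.

Hypothesis H1 : forall Y, above w Y -> size Y = 1 -> fertility (w ++ Y) = h1.

(** One more descending entry adds [2 * h0]: the cut before [x] and the cut behind all of [Y] both
    leave equal lengths. *)
Lemma fertility_desc1 X Y : descends_to X w -> above (X ++ w) Y ->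
  size Y = (size X).+1 -> fertility (X ++ w ++ Y) = (size X * h0).*2 + h1.
Proof.
elim: X Y => [|x X IHX] Y; first by move=> _; apply: H1.
case/lastP: Y => // Y y dX aY; rewrite size_rcons => -[sY].
have [dX' aY1 aY2 ->] := fertility_step dX aY.
rewrite (@fertility_desc0 (x :: X)) // IHX // sY big_nat_recr //= -sY.
rewrite take_size drop_size (@fertility_desc0 (x :: X)) // fertility_nil.
rewrite big1_seq => [|j]; first by lia.
rewrite mem_index_iota => /andP[_ jY].
by rewrite (@fertility_desc_eq0 (x :: X)) ?above_take // size_take_min /=; lia.
Qed.

Hypothesis H2 : forall Y, above w Y -> size Y = 2 -> fertility (w ++ Y) = h2.

(** Let f_d(c) be the fertility with c descending and c + d ascending entries. Then f_2(c + 1) =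
    f_2(c) + 2 f_1(c + 1) + h0. *)
Lemma fertility_desc2 X Y : descends_to X w -> above (X ++ w) Y ->
  size Y = (size X).+2 ->
  fertility (X ++ w ++ Y) =
    size X * (size X).+1 * h0.*2 + (size X * h1).*2 + size X * h0 + h2.
Proof.
elim: X Y => [|x X IHX] Y; first by move=> _; apply: H2.
case/lastP: Y => // Y y dX aY; rewrite size_rcons => -[sY].
have [dX' aY1 aY2 ->] := fertility_step dX aY.
rewrite (@fertility_desc1 (x :: X)) // IHX // sY big_nat_recr //= -sY.
rewrite take_size drop_size (@fertility_desc1 (x :: X)) // fertility_nil.
(* The cut leaving a single entry of [Y] behind contributes [h0] times 1; all shorter prefixes are
   infertile. *)
rewrite {1}sY big_nat_recr //= (@fertility_desc0 (x :: X)) ?above_take //;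
  last first.
  by rewrite size_take_min /=; lia.
have [z ->] : exists z, drop (size X).+1 Y = [:: z].
  move: (size_drop (size X).+1 Y); rewrite sY subSnn.
  by case: drop => // z [|//] _; exists z.
rewrite fertility_seq1 big1_seq => [|j]; first by lia.
rewrite mem_index_iota => /andP[_ jY].
by rewrite (@fertility_desc_eq0 (x :: X)) ?above_take // size_take_min /=; lia.
Qed.

End Profile.

Lemma above_iota u m n : all (fun z => z < m) u -> above u (iota m n).
Proof.
move=> um; apply/andP; split.
  by rewrite -(sorted_pairwise ltn_trans) iota_ltn_sorted.
by apply/allrelP => y z /(allP um) ym;
  rewrite mem_iota => /andP[/(leq_trans ym)].
Qed.

Lemma descends_to_rev_iota w m n : uniq w -> w != [::] ->
  all (fun z => z < m) w -> descends_to (rev (iota m n)) w.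
Proof.
move=> uw w0 wm; apply/and4P; split=> //.
  rewrite -(sorted_pairwise (rev_trans ltn_trans)) rev_sorted.
  exact: iota_ltn_sorted.
apply/allrelP => y z; rewrite mem_rev mem_iota => /andP[my _] /(allP wm) zm.
exact: leq_trans zm my.
Qed.

(* Witness: c descending entries, then the block a .. 2 1 (a+1) .. (2a) of
   smaller entries, then c+1 ascending entries larger than everything else. *)
Lemma fertility_numbers_mul a c : 0 < a ->
  fertility_numbers (a * (4 * c + 2 * a + 3)).
Proof.
case: a => // a _.
set X := rev (iota 2 a); set Y := iota (a + 2) a.+1.
set w := X ++ [:: 1] ++ Y.
set X' := rev (iota (2 * a + 3) c).
set Y' := iota (2 * a + 3 + c) c.+1.
have sX : size X = a by rewrite size_rev size_iota.
have sX' : size X' = c by rewrite size_rev size_iota.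
have dX : descends_to X [:: 1] by apply: descends_to_rev_iota.
have memX z : (z \in X) = (2 <= z < 2 + a) by rewrite mem_rev mem_iota.
have aY : above (X ++ [:: 1]) Y.
  by apply: above_iota; apply/allP => z; rewrite mem_cat memX !inE; lia.
have bX z : z \in w -> 0 < z < 2 * a + 3.
  by rewrite !mem_cat memX mem_iota !inE; lia.
have uw : uniq w by rewrite /w catA above_uniq ?descends_to_uniq.
have dX' : descends_to X' w.
  apply: descends_to_rev_iota => //; first by rewrite /w; case: (X).
  by apply/allP => z /bX; lia.
have aY' : above (X' ++ w) Y'.
  apply: above_iota; apply/allP => z; rewrite mem_cat mem_rev mem_iota.
  by case/orP=> [|/bX]; lia.
(* The block [[:: 1]] has the values 1, 2, 5: the Catalan numbers, which are the fertilities of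
   increasing words. *)
have h1 Z : above [:: 1] Z -> size Z = 1 -> fertility ([:: 1] ++ Z) = 2.
  case: Z => [|z1 [|//]] // /andP[_]; rewrite allrel1l /= andbT => z1P _.
  rewrite (fertility_rcons (t := [:: 1])) //= ?z1P //.
  by rewrite unlock /= !fertility_seq1.
have h2 Z : above [:: 1] Z -> size Z = 2 -> fertility ([:: 1] ++ Z) = 5.
  case: Z => [|z1 [|z2 [|//]]] // /andP[/= z12]; rewrite allrel1l /= => z1P _.
  have z1E := h1 [:: z1]; rewrite /above allrel1l /= in z1E.
  rewrite (fertility_rcons (t := [:: 1; z1])) /= ?inE; try lia.
  by rewrite unlock /= !fertility_seq1 z1E //; lia.
(* The inner application, around [1], yields the values h0 and h1 for [w]; the outer one, around
   [w], then gives 2 c h0 + h1. *)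
have H0 : fertility w = 2 * a.+1.
  by rewrite (@fertility_desc1 _ 1 2) ?sX ?size_iota //; lia.
have H1 Z : above w Z -> size Z = 1 ->
    fertility (w ++ Z) = a.+1 * (2 * a.+1 + 3).
  move=> aZ sZ; rewrite /w -!catA (@fertility_desc2 _ 1 2 5) //.
  - by rewrite sX; nia.
  - by rewrite above_catr aY -catA.
  - by rewrite size_cat sX sZ size_iota; lia.
have <- : fertility (X' ++ w ++ Y') = a.+1 * (4 * c + 2 * a.+1 + 3).
  by rewrite (fertility_desc1 H0 H1) ?sX' ?size_iota //; nia.
apply/fertilityP/andP; split.
  by rewrite catA above_uniq ?descends_to_uniq.
apply/allP => z; rewrite mem_cat (mem_cat _ w) mem_rev !mem_iota.
by case/or3P => [|/bX|]; lia.
Qed.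

(** * Primes congruent to 3 modulo 4 *)

Local Open Scope ring_scope.

Definition chi4 (n : nat) : rat :=
  if (n %% 4 == 1)%N then 1 else if (n %% 4 == 3)%N then -1 else 0.

Lemma chi4M a b : chi4 (a * b) = chi4 a * chi4 b.
Proof.
rewrite /chi4 -modnMm; have := ltn_pmod a (isT : 0 < 4)%N.
have := ltn_pmod b (isT : 0 < 4)%N.
by move: (a %% 4)%N (b %% 4)%N => [|[|[|[|?]]]] [|[|[|[|?]]]] //= _ _;
  rewrite ?mulr0 ?mul0r ?mulr1 ?mul1r ?mulN1r ?opprK.
Qed.

(** A divisor d of a b is the product of gcd(d, a) and d / gcd(d, a), and this is its only
    factorization into a divisor of a and one of b. *)
Lemma big_divisors_coprime (F : nat -> rat) a b : coprime a b ->
  (0 < a)%N -> (0 < b)%N ->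
  \sum_(d <- divisors (a * b)) F d =
  \sum_(x <- divisors a) \sum_(y <- divisors b) F (x * y)%N.
Proof.
move=> cab a0 b0; have -> := esym (@big_allpairs_dep _ _ _ nat (fun=> nat) nat
  muln (divisors a) (fun=> divisors b) F).
apply/perm_big/uniq_perm.
- exact: divisors_uniq.
- apply: allpairs_uniq; rewrite ?divisors_uniq // => p p'.
  move=> /allpairsP[[x y] /= [xa yb ->]] /allpairsP[[x' y'] /= [xa' yb' ->]] /=
    xyE.
  rewrite -!dvdn_divisors // in xa yb xa' yb'.
  have gcdE u v : (u %| a -> v %| b -> gcdn a (u * v) = u)%N.
    by move=> ua vb; rewrite Gauss_gcdl ?(coprime_dvdr vb) //; apply/gcdn_idPr.
  have xE : x = x' by rewrite -(gcdE x y) // xyE gcdE.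
  move: xyE; rewrite -xE => /eqP;
    rewrite eqn_pmul2l ?(dvdn_gt0 _ xa) // => /eqP-> //.
move=> d; rewrite -dvdn_divisors ?muln_gt0 ?a0 //;
  apply/idP/allpairsP => [dab|].
  have g0 : (0 < gcdn d a)%N by rewrite gcdn_gt0 a0 orbT.
  exists (gcdn d a, d %/ gcdn d a)%N; rewrite -!dvdn_divisors //=; split.
  - exact: dvdn_gcdr.
  - have dg : coprime (d %/ gcdn d a) (a %/ gcdn d a).
      by rewrite /coprime -(eqn_pmul2r g0) mul1n muln_gcdl !divnK ?dvdn_gcdl
        ?dvdn_gcdr.
    rewrite -(Gauss_dvdr _ dg) -(dvdn_pmul2r g0) divnK ?dvdn_gcdl //.
    by rewrite mulnAC divnK ?dvdn_gcdr.
  - by rewrite mulnC divnK ?dvdn_gcdl.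
by move=> [[x y] /= []]; rewrite -!dvdn_divisors // => xa yb ->;
  apply: dvdn_mul.
Qed.

(** For positive [n], a quarter of the number of representations of [n] as a sum of two squares. *)
Definition r4 (n : nat) : rat := \sum_(d <- divisors n) chi4 d.

(** For c < 0 the sum is (1 - c^n) / (1 - c), and c^n <= 1. *)
Lemma sum_expr_ge0 (c : rat) n : -1 <= c -> 0 <= \sum_(i < n) c ^+ i.
Proof.
move=> c1; have [c0|c0] := leP 0 c; first by apply: sumr_ge0 => i _;
  apply: exprn_ge0.
have cn : c ^+ n <= 1.
  apply: le_trans (ler_norm _) _; rewrite normrX exprn_ile1 //.
  by rewrite ler_norml c1 ltW // (lt_trans c0).
have c2 : 0 < 1 - c by lra.
rewrite -(pmulr_rge0 _ c2) -opprB mulNr -subrX1; lra.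
Qed.

Lemma chi4_pow p i : chi4 (p ^ i) = chi4 p ^+ i.
Proof. by elim: i => // i IH; rewrite expnS exprS chi4M IH. Qed.

Lemma r4_prime_pow_ge0 p e : prime p -> 0 <= r4 (p ^ e).
Proof.
move=> pp; rewrite /r4.
have -> : \sum_(d <- divisors (p ^ e)) chi4 d = \sum_(i < e.+1) chi4 p ^+ i.
  under [RHS]eq_bigr do rewrite -chi4_pow.
  rewrite -(big_mkord predT (fun i => chi4 (p ^ i)%N)).
  rewrite -(big_map (expn p) predT chi4).
  apply/perm_big/uniq_perm.
  - exact: divisors_uniq.
  - by rewrite map_inj_uniq ?iota_uniq //; apply: expnI; exact: prime_gt1.
  move=> d; rewrite -dvdn_divisors ?expn_gt0 ?prime_gt0 //.
  apply/(dvdn_pfactor _ _ pp)/mapP => -[i iP ->]; exists i => //;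
    by move: iP; rewrite mem_index_iota.
apply: sum_expr_ge0; rewrite /chi4; case: ifP => // _; case: ifP => // _.
Qed.

(** By multiplicativity: the full power of the least prime factor splits off, and the cofactor is
    smaller. *)
Lemma r4_ge0 n : (0 < n)%N -> 0 <= r4 n.
Proof.
have [k] := ubnP n; elim: k n => // k IH n nk n0.
have [->|n1] := eqVneq n 1%N; first by rewrite /r4 /= big_seq1.
have pp : prime (pdiv n) by apply: pdiv_prime; lia.
have [m cpm nE] := pfactor_coprime pp n0.
have e0 : (0 < logn (pdiv n) n)%N by rewrite logn_gt0 mem_primes pp n0 pdiv_dvd.
have m0 : (0 < m)%N by move: n0; rewrite {1}nE muln_gt0 => /andP[].
have cmp : coprime m (pdiv n ^ logn (pdiv n) n)
  by rewrite coprimeXr // coprime_sym.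
have pe0 : (0 < pdiv n ^ logn (pdiv n) n)%N by rewrite expn_gt0 prime_gt0.
rewrite {1}nE /r4 big_divisors_coprime //.
have -> : \sum_(x <- divisors m) \sum_(y <- divisors (pdiv n ^ logn (pdiv n) n))
    chi4 (x * y) = r4 m * r4 (pdiv n ^ logn (pdiv n) n).
  by rewrite big_distrlr /=; do 2![apply: eq_bigr => ? _]; rewrite chi4M.
rewrite mulr_ge0 ?r4_prime_pow_ge0 //; apply: IH => //.
apply: (@leq_trans n) => //; rewrite [X in (_ < X)%N]nE ltn_Pmulr //.
by rewrite -[1%N](expn0 (pdiv n)) ltn_exp2l ?prime_gt1.
Qed.

(** * Divisor sums and harmonic sums *)

Lemma big_nat_dvdn (G : nat -> rat) X d : (0 < d)%N ->
  \sum_(1 <= n < X.+1 | (d %| n)%N) G (n %/ d)%N =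
  \sum_(1 <= k < (X %/ d).+1) G k.
Proof.
move=> d0; elim: X => [|X IH]; first by rewrite div0n !big_geq.
rewrite big_mkcond big_nat_recr //= -big_mkcond IH divnS //.
case: (d %| X.+1)%N; last by rewrite addr0.
by rewrite add1n [RHS]big_nat_recr.
Qed.

(** Both sides run over the pairs of positive d, k with d k <= X. *)
Lemma big_nat_divisors (F : nat -> nat -> rat) X :
  \sum_(1 <= n < X.+1) \sum_(d <- divisors n) F d (n %/ d)%N =
  \sum_(1 <= d < X.+1) \sum_(1 <= k < (X %/ d).+1) F d k.
Proof.
transitivity (\sum_(1 <= n < X.+1)
  \sum_(1 <= d < X.+1 | (d %| n)%N) F d (n %/ d)%N).
  apply: eq_big_nat => n /andP[n0 nX]; rewrite -[RHS]big_filter.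
  apply: perm_big; apply: uniq_perm;
    rewrite ?divisors_uniq ?filter_uniq ?iota_uniq //.
  move=> d; rewrite mem_filter mem_index_iota -dvdn_divisors //.
  case: (boolP (d %| n)%N) => //= dn; apply/esym/andP; split;
    first exact: dvdn_gt0 n0 dn.
  exact: leq_ltn_trans (dvdn_leq n0 dn) nX.
rewrite (exchange_big_dep_nat predT) //=.
by apply: eq_big_nat => d /andP[d0 _]; rewrite big_nat_dvdn.
Qed.

Definition harm (X : nat) : rat := \sum_(1 <= n < X.+1) n%:R^-1.

Lemma ler_sum_widen (F : nat -> rat) m n : (m <= n)%N -> (forall i, 0 <= F i) ->
  \sum_(1 <= i < m.+1) F i <= \sum_(1 <= i < n.+1) F i.
Proof.
move=> mn F0; rewrite (@big_cat_nat _ _ _ m.+1 1 n.+1) //=.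
by rewrite lerDl sumr_ge0.
Qed.

(** A period contributes u(4n + 1) - u(4n + 3) <= u(4n + 1) - u(4n + 5), and these bounds
    telescope. *)
Lemma alternating_sum_le (u : nat -> rat) n :
  (forall d, (0 < d)%N -> u d.+1 <= u d) ->
  \sum_(1 <= d < (4 * n).+1) chi4 d * u d <= u 1%N - u (4 * n).+1.
Proof.
move=> umono; elim: n => [|n IH]; first by rewrite big_geq // subrr.
rewrite (_ : (4 * n.+1).+1 = (4 * n).+1.+4)%N; last by lia.
rewrite 4?big_nat_recr //=.
have -> : chi4 (4 * n).+1 = 1 by rewrite /chi4 (_ : _ %% 4 = 1)%N //; lia.
have -> : chi4 (4 * n).+2 = 0 by rewrite /chi4 (_ : _ %% 4 = 2)%N //; lia.
have -> : chi4 (4 * n).+3 = -1 by rewrite /chi4 (_ : _ %% 4 = 3)%N //; lia.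
have -> : chi4 (4 * n).+4 = 0 by rewrite /chi4 (_ : _ %% 4 = 0)%N //; lia.
have u54 := umono (4 * n).+4 isT; have u43 := umono (4 * n).+3 isT.
lra.
Qed.

Lemma sum_r4_le (X : nat) : \sum_(1 <= n < X.+1) r4 n / n%:R <= harm X.
Proof.
(* [u d] sums the reciprocals of the multiples of [d] up to [X]: it decreases in [d], and [u 1] is
   the harmonic sum. *)
pose u d := \sum_(1 <= k < (X %/ d).+1) (d * k)%:R^-1 : rat.
have u0 d : 0 <= u d by apply: sumr_ge0 => k _; rewrite invr_ge0.
have umono d : (0 < d)%N -> u d.+1 <= u d.
  move=> d0; apply: (@le_trans _ _
    (\sum_(1 <= k < (X %/ d.+1).+1) (d * k)%:R^-1)).
    apply: ler_sum_nat => k /andP[k0 _].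
    by rewrite lef_pV2 ?posrE ?ltr0n ?muln_gt0 ?d0 // ler_nat leq_mul2r leqnSn
      orbT.
  apply: ler_sum_widen; first exact: leq_div2l.
  by move=> k; rewrite invr_ge0.
have -> : \sum_(1 <= n < X.+1) r4 n / n%:R = \sum_(1 <= d < X.+1) chi4 d * u d.
  under [RHS]eq_bigr do rewrite mulr_sumr.
  rewrite -(big_nat_divisors (fun d k => chi4 d * (d * k)%:R^-1)).
  apply: eq_big_nat => n /andP[n0 _]; rewrite mulr_suml.
  apply: eq_big_seq => d; rewrite -dvdn_divisors // => dn.
  by rewrite mulnC divnK.
have -> : harm X = u 1%N by rewrite /u divn1; apply: eq_bigr => k _;
  rewrite mul1n.
have uX d : (X < d)%N -> u d = 0 by move=> Xd; rewrite /u divn_small // big_geq.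
(* Extending the range to whole periods is harmless, as [u] vanishes beyond [X]. *)
rewrite (_ : \sum_(_ <= d < _) _ = \sum_(1 <= d < (4 * X).+1) chi4 d * u d).
  by apply: le_trans (alternating_sum_le X umono) _; rewrite gerBl.
rewrite [RHS](@big_cat_nat _ _ _ X.+1) //=; last by lia.
rewrite [X in _ + X]big1_seq ?addr0 // => d;
  rewrite mem_index_iota => /andP[_ /andP[Xd _]].
by rewrite uX // mulr0.
Qed.

(** For positive x and y, passing from x y to x (y + 1) adds x terms, each at most 1 / (x y), so at
    most 1 / y in all. *)
Lemma harmM x y : harm (x * y) <= harm x + harm y.
Proof.
case: y => [|y].
  rewrite muln0 /harm [X in X <= _]big_geq // addr_ge0 // sumr_ge0 // => i _;
    by rewrite invr_ge0.
apply: (@le_trans _ _ (harm x + harm y)); last first.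
  rewrite lerD2l; apply: ler_sum_widen => // i; by rewrite invr_ge0.
elim: y => [|y IH]; first by rewrite muln1 lerDl /harm big_geq.
rewrite [in X in _ + X]/harm big_nat_recr //= addrA -/(harm y).
rewrite mulnS addnC [X in X <= _]/harm (@big_cat_nat _ _ _ (x * y.+1).+1) //=;
  last by lia.
rewrite lerD //.
have [->|x0] := posnP x; first by rewrite addn0 big_geq // invr_ge0.
apply: (@le_trans _ _
  (\sum_((x * y.+1).+1 <= i < (x * y.+1 + x).+1) (x * y.+1)%:R^-1)).
  apply: ler_sum_nat => i /andP[iL _].
  by rewrite lef_pV2 ?posrE ?ltr0n ?muln_gt0 ?x0 // ?ler_nat; lia.
rewrite sumr_const_nat subSS addKn -[X in X <= _]mulr_natr natrM invfM.
by rewrite mulrAC mulVf ?mul1r // pnatr_eq0; lia.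
Qed.

(** Each of the 2^k terms past 2^k, up to 2^(k+1), is at least 1 / 2^(k+1), so such a dyadic block
    adds at least 1/2. *)
Lemma harm_pow2 k : k%:R / 2 <= harm (2 ^ k).
Proof.
elim: k => [|k IH]; first by rewrite mul0r sumr_ge0 // => i _; rewrite invr_ge0.
rewrite -natr1 mulrDl; apply: le_trans (lerD IH (lexx _)) _.
rewrite expnS mul2n -addnn [X in _ <= X]/harm (@big_cat_nat _ _ _ (2 ^ k).+1)
  //=; last by lia.
rewrite -/(harm _) lerD2l.
apply: (@le_trans _ _
  (\sum_((2 ^ k).+1 <= i < (2 ^ k + 2 ^ k).+1) (2 * 2 ^ k)%:R^-1)).
  rewrite sumr_const_nat subSS addKn -[X in _ <= X]mulr_natr natrM invfM.
  by rewrite -mulrA mulVf ?mulr1 ?mul1r // pnatr_eq0 expn_eq0.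
apply: ler_sum_nat => i /andP[iL iU].
by rewrite lef_pV2 ?posrE ?ltr0n ?muln_gt0 ?expn_gt0 // ?ler_nat; lia.
Qed.

(** * Integers with restricted prime factors *)

Definition primes1mod4_or (ps : seq nat) (n : nat) : bool :=
  all (fun p => (p %% 4 == 1)%N || (p \in ps)) (primes n).

Lemma primes1mod4_orM ps a b : (0 < a)%N -> (0 < b)%N ->
  primes1mod4_or ps (a * b) = primes1mod4_or ps a && primes1mod4_or ps b.
Proof.
move=> a0 b0; apply/allP/andP => [H|[/allP Ha /allP Hb] p].
  by split; apply/allP => p pP; apply: H; rewrite primesM // pP ?orbT.
by rewrite primesM // => /orP[/Ha|/Hb].
Qed.

Lemma primes1mod4_chi4 n : (0 < n)%N -> primes1mod4_or [::] n -> chi4 n = 1.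
Proof.
have [k] := ubnP n; elim: k n => // k IH n nk n0 sn.
have [->//|n1] := eqVneq n 1%N.
have pp : prime (pdiv n) by apply: pdiv_prime; lia.
have /dvdnP[m nE] := pdiv_dvd n.
have m0 : (0 < m)%N by move: n0; rewrite nE muln_gt0 => /andP[].
have p0 := prime_gt0 pp.
move: sn; rewrite {1}nE primes1mod4_orM // => /andP[sm sp].
rewrite nE chi4M IH //; last first.
  by apply: (@leq_trans n) => //;
    rewrite [X in (_ < X)%N]nE ltn_Pmulr ?prime_gt1.
move: sp; rewrite /primes1mod4_or primes_prime //= orbF andbT => p1.
by rewrite mul1r /chi4 p1.
Qed.

(** The list [ps] is a parameter so that the additional primes can be removed one at a time. *)
Definition harm_primes1mod4_or (ps : seq nat) (z : nat) : rat :=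
  \sum_(1 <= n < z.+1 | primes1mod4_or ps n) n%:R^-1.

(** The square is regrouped by n = a b. For admissible [n], all divisors have [chi4] equal to 1, so
    the inner sum becomes [r4 n / n]. *)
Lemma harm_primes1mod4_or_sqr_le z :
  harm_primes1mod4_or [::] z ^+ 2 <= harm (z ^ 2).
Proof.
pose e n : rat := if primes1mod4_or [::] n then n%:R^-1 else 0.
have e0 n : 0 <= e n by rewrite /e; case: ifP => // _; rewrite invr_ge0.
have -> : harm_primes1mod4_or [::] z = \sum_(1 <= n < z.+1) e n.
  by rewrite /harm_primes1mod4_or big_mkcond.
apply: le_trans (sum_r4_le _).
rewrite expr2 big_distrl /=.
(* The square a, b <= z is enlarged to the region a b <= z^2. *)
apply: (@le_trans _ _ (\sum_(1 <= a < (z ^ 2).+1)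
                       \sum_(1 <= b < (z ^ 2 %/ a).+1) e a * e b)).
  apply: (@le_trans _ _ (\sum_(1 <= a < z.+1)
                       \sum_(1 <= b < (z ^ 2 %/ a).+1) e a * e b)).
    apply: ler_sum_nat => a /andP[a0 az]; rewrite mulr_sumr;
      apply: ler_sum_widen.
      by rewrite leq_divRL // -mulnn leq_mul2l -ltnS az orbT.
    by move=> b; rewrite mulr_ge0.
  apply: ler_sum_widen; first by rewrite -mulnn; nia.
  by move=> a; apply: sumr_ge0 => b _; rewrite mulr_ge0.
rewrite -(big_nat_divisors (fun a b => e a * e b)).
apply: ler_sum_nat => n /andP[n0 _].
have [sn|nsn] := boolP (primes1mod4_or [::] n).
  rewrite /r4 mulr_suml [X in _ <= X]big_seq big_seq.
  apply: ler_sum => d; rewrite -dvdn_divisors // => dn.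
  have nd0 : (0 < n %/ d)%N by rewrite divn_gt0 ?(dvdn_gt0 n0 dn) // dvdn_leq.
  move: sn; rewrite -{1}(divnK dn) primes1mod4_orM ?(dvdn_gt0 n0 dn) // =>
    /andP[s1 s2].
  rewrite primes1mod4_chi4 ?(dvdn_gt0 n0 dn) // /e s1 s2.
  by rewrite -invfM -natrM mulnC divnK // mul1r.
(* For inadmissible [n] one of the two factors is inadmissible, so the left side is 0, and [r4 n] is
   nonnegative. *)
rewrite big1_seq ?divr_ge0 ?r4_ge0 // => d /andP[_].
rewrite -dvdn_divisors // => dn.
have nd0 : (0 < n %/ d)%N by rewrite divn_gt0 ?(dvdn_gt0 n0 dn) // dvdn_leq.
move: nsn; rewrite -{1}(divnK dn) primes1mod4_orM ?(dvdn_gt0 n0 dn) // /e.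
by case: primes1mod4_or => /= [/negbTE->|_]; rewrite ?mul0r ?mulr0.
Qed.

(** One step of the Euler product: the multiples n = p k contribute at most 1/p times the whole sum,
    and the other terms are admissible without [p]. *)
Lemma harm_primes1mod4_or_cons p ps z : (0 < p)%N ->
  harm_primes1mod4_or (p :: ps) z * (1 - p%:R^-1) <= harm_primes1mod4_or ps z.
Proof.
move=> p0; rewrite mulrBr mulr1 lerBlDr.
rewrite {1}/harm_primes1mod4_or (bigID (fun n => p %| n)%N) /= addrC lerD //.
  rewrite /harm_primes1mod4_or big_mkcond [X in _ <= X]big_mkcond.
  apply: ler_sum_nat => n /andP[n0 _]; case: ifP => [/andP[sn pn]|_];
    last first.
    by case: ifP => // _; rewrite invr_ge0.
  rewrite ifT //; apply/allP => q qn; move/allP: sn => /(_ q qn).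
  rewrite inE orbCA => /orP[/eqP qp|//].
  by move: pn; rewrite -qp; move: qn; rewrite mem_primes => /and3P[_ _ ->].
pose e n : rat := if primes1mod4_or (p :: ps) n then n%:R^-1 else 0.
have e0 n : 0 <= e n by rewrite /e; case: ifP => // _; rewrite invr_ge0.
apply: (@le_trans _ _ (\sum_(1 <= n < z.+1 | (p %| n)%N) e (n %/ p)%N / p%:R)).
  rewrite big_mkcond [X in _ <= X]big_mkcond.
  apply: ler_sum_nat => n /andP[n0 _]; rewrite andbC;
    case: ifP => [/andP[pn sn]|]; last first.
    by move=> _; case: ifP => // _; rewrite divr_ge0.
  rewrite pn /e.
  have nd0 : (0 < n %/ p)%N by rewrite divn_gt0 // dvdn_leq.
  move: sn; rewrite -{1}(divnK pn) primes1mod4_orM // => /andP[-> _].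
  by rewrite -invfM -natrM divnK.
rewrite (big_nat_dvdn (fun k => e k / p%:R)) //.
rewrite -mulr_suml ler_wpM2r ?invr_ge0 //.
rewrite /harm_primes1mod4_or [X in _ <= X]big_mkcond;
  apply: ler_sum_widen => //.
exact: leq_div.
Qed.

Lemma harm_primes1mod4_or_prod ps z : all (leq 1) ps ->
  harm_primes1mod4_or ps z * \prod_(p <- ps) (1 - p%:R^-1) <=
    harm_primes1mod4_or [::] z.
Proof.
elim: ps => [|p ps IH] /=; first by rewrite big_nil mulr1.
case/andP=> p0 ps0; rewrite big_cons mulrA; apply: le_trans (IH ps0).
rewrite ler_wpM2r ?harm_primes1mod4_or_cons // big_seq prodr_ge0 // =>
  q /(allP ps0) q0.
by rewrite subr_ge0 invf_le1 ?ler1n ?ltr0n.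
Qed.

Definition primes3mod4 (z : nat) : seq nat :=
  [seq p <- iota 0 z.+1 | prime p && (p %% 4 == 3)%N].

Lemma prod_primes3mod4_le z :
  harm z * (\prod_(p <- primes3mod4 z) (1 - p%:R^-1)) ^+ 2 <= 8.
Proof.
have [->|z0] := posnP z; first by rewrite /harm big_geq // mul0r.
set P := \prod_(p <- _) _.
have H0 : 0 < harm z.
  rewrite /harm big_nat_recl // ltr_pwDl //.
  by rewrite sumr_ge0 // => i _; rewrite invr_ge0.
have ps0 : all (leq 1) (2%N :: primes3mod4 z).
  by apply/allP => p; rewrite inE mem_filter =>
    /orP[/eqP->//|/andP[/andP[/prime_gt0]]].
have P0 : 0 <= P.
  rewrite /P big_seq prodr_ge0 // => q qz.
  have q0 : (0 < q)%N by apply: (allP ps0); rewrite inE qz orbT.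
  by rewrite subr_ge0 invf_le1 ?ler1n ?ltr0n.
(* Adding the prime 2 makes every [n <= z] admissible, at the cost of a factor 1/2. *)
have := harm_primes1mod4_or_prod z ps0; rewrite big_cons -/P.
have -> : harm_primes1mod4_or (2%N :: primes3mod4 z) z = harm z.
  rewrite /harm_primes1mod4_or /harm big_mkcond;
    apply: eq_big_nat => n /andP[n0 nz].
  rewrite ifT //; apply/allP => p; rewrite mem_primes => /and3P[pp _ pn].
  rewrite inE mem_filter pp mem_iota /= add0n (leq_ltn_trans (dvdn_leq n0 pn)
    nz) andbT.
  have [->|/eqP p2] := eqVneq p 2%N; first by rewrite orbT.
  have /(even_prime) := pp; case=> // podd.
  by rewrite /=; lia.
move=> h1.
have h0 : 0 <= harm z * ((1 - 2%:R^-1) * P).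
  apply: (mulr_ge0 (ltW H0)); apply: (mulr_ge0 _ P0).
  by rewrite subr_ge0 invf_le1 ?ltr0n ?ler1n.
have := le_trans (lerXn2r 2 _ _ h1) (le_trans (harm_primes1mod4_or_sqr_le z)
  (harmM z z)).
rewrite !nnegrE h0 (le_trans h0 h1) => /(_ isT isT) h2.
(* Multiplied by H = [harm z], the goal is (H P)^2 <= 8 H, which is four times (H P / 2)^2 <= 2
   H. *)
rewrite -(ler_pM2l H0); move: h2; set h := harm z.
have -> : (h * ((1 - 2^-1) * P)) ^+ 2 = h * (h * P ^+ 2) / 4 by field.
lra.
Qed.

(** * Counting integers coprime to the product of these primes *)

Definition prod_primes3mod4 z : nat := (\prod_(p <- primes3mod4 z) p)%N.

Lemma totient_prod_primes (ps : seq nat) : uniq ps -> all prime ps ->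
  (totient (\prod_(p <- ps) p)%N)%:R =
  (\prod_(p <- ps) p)%N%:R * \prod_(p <- ps) (1 - p%:R^-1) :> rat.
Proof.
elim: ps => [|p ps IH]; first by rewrite !big_nil mulr1.
move=> /= /andP[pps ups] /andP[pp aps]; rewrite !big_cons totient_coprime.
  rewrite !natrM IH // totient_prime // -subn1 natrB ?prime_gt0 //.
  by field; rewrite pnatr_eq0 -lt0n prime_gt0.
rewrite big_seq; apply: (big_ind (coprime p)) => [||q qps];
  first exact: coprimen1.
  by move=> m n pm pn; rewrite coprimeMr pm.
rewrite prime_coprime // dvdn_prime2 ?(allP aps q qps) //.
by apply: contraNneq pps => ->.
Qed.

(** With z = 2^(16 K^2) the harmonic sum is at least 8 K^2, so K P > 1 would contradict H P^2 <= 8;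
    and the totient of Q is Q P. *)
Lemma totient_primes3mod4_small K : exists z,
  (K * totient (prod_primes3mod4 z) <= prod_primes3mod4 z)%N.
Proof.
have [->|K0] := posnP K; first by exists 0%N.
exists (2 ^ (16 * K ^ 2))%N; set z := (2 ^ _)%N.
rewrite -(ler_nat rat) natrM /prod_primes3mod4 totient_prod_primes; first last.
- by apply/allP => p; rewrite mem_filter => /andP[/andP[]].
- by rewrite filter_uniq // iota_uniq.
set Q := (\prod_(p <- _) p)%N%:R.
set P := \prod_(p <- _) _.
have hP : harm z * P ^+ 2 <= 8 := prod_primes3mod4_le z.
have hK : (16 * K ^ 2)%:R / 2 <= harm z := harm_pow2 _.
rewrite mulrCA -[leRHS]mulr1 ler_wpM2l //.
rewrite leNgt; apply/negP => KP.
have KP2 : 1 < (K%:R * P) ^+ 2 by rewrite expr_gt1 // ltW // (lt_trans ltr01).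
have := ler_wpM2r (sqr_ge0 P) hK; rewrite natrM natrX.
have -> : 16%:R * K%:R ^+ 2 / 2 * P ^+ 2 = 8 * (K%:R * P) ^+ 2 by field.
by lra.
Qed.

(** The range is rounded up to full periods of length [Q], each containing [totient Q] integers
    coprime to [Q]. *)
Lemma count_coprime_le Q N : (0 < Q)%N ->
  (\sum_(0 <= n < N.+1) coprime Q n <= (N %/ Q).+1 * totient Q)%N.
Proof.
move=> Q0.
have count m : (\sum_(0 <= n < m * Q) coprime Q n = m * totient Q)%N.
  elim: m => [|m IH]; first by rewrite big_geq.
  rewrite mulSn addnC (@big_cat_nat _ _ _ (m * Q)%N) ?leq_addr //= IH.
  rewrite -{1}[(m * Q)%N]add0n big_addn addKn mulSn addnC; congr addn.
  rewrite totient_count_coprime; apply: eq_bigr => i _.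
  by rewrite /coprime addnC gcdnMDl.
rewrite -count [leqRHS](@big_cat_nat _ _ _ N.+1) ?leq_addr //=.
by rewrite ltn_ceil.
Qed.

(** * Density *)

Local Open Scope nat_scope.

(** 2 a + 3 is 1 or 3 mod 4 according as a is odd or even, so c - (2 a + 3) is a multiple of 4. *)
Lemma fertility_numbers_mod4 a c : 0 < a -> c %% 4 = (if odd a then 1 else 3) ->
  2 * a + 3 <= c -> fertility_numbers (a * c).
Proof.
move=> a0 c4 ac.
have -> : c = 4 * ((c - (2 * a + 3)) %/ 4) + 2 * a + 3 by case: ifP c4; lia.
exact: fertility_numbers_mul.
Qed.

Lemma fertility_numbers_dvd k z p n : prime p -> p %% 4 = 3 -> p <= z ->
  p %| n -> ~~ (2 ^ k %| n) -> 2 ^ k * z * (2 * (2 ^ k * z) + 3) <= n ->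
  fertility_numbers n.
Proof.
move=> pp p4 pz pn nk nB.
have z0 : 0 < z := leq_trans (prime_gt0 pp) pz.
have n0 : 0 < n by apply: leq_trans nB; rewrite !muln_gt0 expn_gt0 z0; lia.
(* Both candidates for [a], namely 2^e and 2^e p, are at most 2^k z, so one bound on [n] serves for
   both. *)
have big a c : a * c = n -> 0 < a -> a <= 2 ^ k * z -> 2 * a + 3 <= c.
  move=> acn a0 aB; rewrite -(leq_pmul2l a0) acn; apply: leq_trans nB.
  by apply: leq_mul => //; lia.
have [m c2m nE] := pfactor_coprime (isT : prime 2) n0.
set e := logn 2 n in nE.
have ek : e < k by rewrite ltnNge -pfactor_dvdn.
have m_odd : odd m by rewrite -coprime2n.
have pm : p %| m.
  rewrite -(@Gauss_dvdl p m (2 ^ e)) -?nE // coprimeXr //.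
  by rewrite coprime_sym coprime2n; lia.
have ek2 : 2 ^ e <= 2 ^ k by rewrite leq_exp2l // ltnW.
have e20 : 0 < 2 ^ e by rewrite expn_gt0.
(* The class mod 4 required of the cofactor; it is the same for 2^e and 2^e p, as [p] is odd. *)
pose t := if e == 0 then 1 else 3.
have [mt|mt] := eqVneq (m %% 4) t.
  rewrite nE mulnC; apply: fertility_numbers_mod4 => //.
    by rewrite mt oddX /t orbF.
  by apply: big => //; [rewrite nE mulnC | rewrite -[2 ^ e]muln1 leq_mul].
have /dvdnP[c mE] := pm.
have cE : 2 ^ e * p * c = n by rewrite nE mE; lia.
rewrite -cE; apply: fertility_numbers_mod4.
- by rewrite muln_gt0 e20 prime_gt0.
(* As m = c p is odd and p is 3 mod 4, [c] lies in the odd class other than that of [m], which is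
   [t]. *)
- rewrite oddM oddX orbF; have -> : odd p by lia.
  rewrite andbT -/t; have mc : m %% 4 = (c %% 4 * 3) %% 4.
    by rewrite mE -modnMm p4.
  by move: mt; rewrite /t; case: (e == 0) => /= /eqP; lia.
- by apply: big => //; [rewrite muln_gt0 e20 prime_gt0 | rewrite leq_mul].
Qed.

Lemma count_dvdn d N : 0 < d ->
  \sum_(0 <= n < N.+1) (d %| n) = (N %/ d).+1.
Proof.
move=> d0; elim: N => [|N IH]; first by rewrite big_nat1 dvdn0 div0n.
by rewrite big_nat_recr //= IH divnS // addnC addnS.
Qed.

Lemma count_ltn_le M N : \sum_(0 <= n < N) (n < M) <= M.
Proof.
suff : \sum_(0 <= n < N) (n < M) <= minn N M by move/leq_trans; apply;
  exact: geq_minr.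
elim: N => [|N IH]; first by rewrite big_geq.
by rewrite big_nat_recr //=; lia.
Qed.

(** An exception is coprime to [Q], divisible by 2^k, or below [M]; each kind is sparse. *)
Lemma infertile_count K : exists N0, forall N, N0 <= N ->
  K * \sum_(0 <= n < N.+1) ~~ `[< fertility_numbers n >] <= N.
Proof.
have [z zQ] := totient_primes3mod4_small (4 * K).
set Q := prod_primes3mod4 z in zQ.
have Q0 : 0 < Q.
  rewrite /Q /prod_primes3mod4 big_seq prodn_cond_gt0 // => p.
  by rewrite mem_filter => /andP[/andP[/prime_gt0]].
(* Multiplied by [k], the first two kinds count at most N + Q and N + k, the third at most k M. For
   [N] beyond the threshold this is at most 3 N, below the available 4 N. *)
pose k := 4 * K; have kK : k <= 2 ^ k by apply/ltnW/ltn_expl.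
pose M := 2 ^ k * z * (2 * (2 ^ k * z) + 3).
exists (Q + k + k * M); move=> N N0.
have bad n : ~~ `[< fertility_numbers n >] <=
    coprime Q n + (2 ^ k %| n) + (n < M).
  have [//|nM] := ltnP n M; first by rewrite addn1; case: asboolP; lia.
  case: (boolP (2 ^ k %| n)) => [|nk]; first by case: asboolP; lia.
  case: (boolP (coprime Q n)) => [|nQ]; first by case: asboolP; lia.
  have [p [pz pn]] : exists p, p \in primes3mod4 z /\ p %| n.
    have : all prime (primes3mod4 z).
      by apply/allP => p; rewrite mem_filter => /andP[/andP[]].
    move: nQ; rewrite /Q /prod_primes3mod4; elim: primes3mod4 => [|p ps IH].
      by rewrite big_nil coprime1n.
    rewrite big_cons coprimeMl negb_and /= => + /andP[pp psP] => /orP[|].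
      by rewrite prime_coprime // negbK => pn; exists p; rewrite mem_head.
    by move=> /IH/(_ psP)[q [qs qn]]; exists q; rewrite inE qs orbT.
  move: pz; rewrite mem_filter => /andP[/andP[pp /eqP p4]].
  rewrite mem_iota /= add0n ltnS => pz'.
  by rewrite (asboolT (fertility_numbers_dvd pp p4 pz' pn nk nM)).
have : \sum_(0 <= n < N.+1) ~~ `[< fertility_numbers n >] <=
       (N %/ Q).+1 * totient Q + (N %/ 2 ^ k).+1 + M.
  apply: (leq_trans (leq_sum _ (fun n _ => bad n))).
  rewrite !big_split /= count_dvdn ?expn_gt0 // !leq_add ?count_coprime_le
    //.
  exact: count_ltn_le.
move=> /(leq_mul (leqnn k)).
have d1 : k * ((N %/ Q).+1 * totient Q) <= N + Q.
  rewrite mulnCA; apply: leq_trans (leq_mul (leqnn _) zQ) _.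
  by rewrite mulSn addnC leq_add2r leq_trunc_div.
have d2 : k * (N %/ 2 ^ k).+1 <= N + k.
  rewrite mulnS addnC leq_add2r; apply: leq_trans (leq_trunc_div N (2 ^ k)).
  by rewrite mulnC leq_mul.
rewrite !mulnDr /k in d1 d2 *; move: N0; rewrite /k; lia.
Qed.

Theorem theorem5p2 (R : realType) : has_density fertility_numbers (1%R : R).
Proof.
apply/cvgrPdist_le => e e0.
pose K := (Num.bound e^-1).
have Ke : (e^-1 < K%:R)%R by rewrite archi_boundP // invr_ge0 ltW.
have K0 : (0 < K%:R :> R)%R by apply: lt_trans Ke; rewrite invr_gt0.
have Ke' : (K%:R^-1 <= e)%R by rewrite -[e]invrK lef_pV2 ?posrE ?invr_gt0 //
  ltW.
have [N0 N0P] := infertile_count K.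
(* Having [K <= N] covers the case b = 0, where b - 1 is negative. *)
exists (N0 + K).+1 => // N /= NN.
set c := #|_|; pose b := \sum_(0 <= n < N.+1) ~~ `[< fertility_numbers n >].
have cE : c + b = N.+1.
  rewrite /c /b -sum1_card big_mkord big_mkcond -big_split /= -[RHS]card_ord
    -sum1_card.
  by apply: eq_bigr => i _; rewrite inE; case: asboolP.
have bK : K * b <= N by apply: N0P; lia.
have N0' : (0 < N%:R :> R)%R by rewrite ltr0n; lia.
(* There are N + 1 integers up to [N] but the quotient is by [N], hence the shift by one. *)
have -> : (1 - c%:R / N%:R = (b%:R - 1) / N%:R :> R)%R.
  have : (c%:R + b%:R = N%:R + 1 :> R)%R by rewrite -natrD cE natr1.
  by move=> /(canRL (addrK _)) ->; field; rewrite gt_eqF.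
apply: le_trans Ke'; rewrite normrM normfV (gtr0_norm N0') ler_pdivrMr //.
rewrite mulrC ler_pdivlMr // -[X in (_ * X <= _)%R](gtr0_norm K0) -normrM
  ler_norml.
rewrite -(ler_nat R) natrM in bK.
have KN : (K%:R <= N%:R :> R)%R by rewrite ler_nat; lia.
have b0 : (0 <= K%:R * b%:R :> R)%R by rewrite mulr_ge0.
by apply/andP; split; lra.
Qed.
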